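(* Let $H$ be a Hilbert space and let $A$ and $B$ be two unbounded invertible operators in $H$ such that $A$, $B$ and all sums and products formed from them or their adjoints in this statement are densely defined. Suppose that $AB=BA$ and that $D(A^*(B^* )^{-1})\subset D(B^* )$. Then $$(A+B)^*=A^*+B^*.$$
   Context: ''Unbounded operator'' means a linear operator defined on a linear subspace $D(A)$ of $H$, not necessarily bounded. For operators $A,B$: the sum $A+B$ has domain $D(A)\cap D(B)$; the product is $(BA)x=B(Ax)$ with domain $D(BA)=\{x\in D(A): Ax\in D(B)\}$. $A\subset B$ means $D(A)\subset D(B)$ and $A$, $B$ coincide on $D(A)$. Equality of operators includes equality of domains; in particular $AB=BA$ means $D(AB)=D(BA)$ and $ABx=BAx$ for all $x$ in this common domain. Standing assumption: all operators, together with any operation (sum, product) involving them or their adjoints, are densely defined; bounded operators are defined on all of $H$. An operator $A$ is invertible if there is an everywhere defined bounded operator, denoted $A^{-1}$, on $H$ with $A^{-1}A\subset AA^{-1}=I$. If $B$ is densely defined and invertible then so is $B^*$, with $(B^* )^{-1}=(B^{-1})^*$. *)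

(* Defs.v *)
From mathcomp Require Import all_boot all_order all_algebra sesquilinear.
From mathcomp Require Import complex.
From mathcomp Require Import all_classical all_reals all_analysis.

Set Implicit Arguments.
Unset Strict Implicit.
Unset Printing Implicit Defensive.

Import Order.TTheory GRing.Theory Num.Theory.
Import numFieldNormedType.Exports.
Local Open Scope classical_set_scope.
Local Open Scope ring_scope.

(* Real and complex Hilbert spaces are treated uniformly. *)
Variant scalar_kind := RealScalars | ComplexScalars.

Definition scalarField (R : realType) (k : scalar_kind) : numFieldType :=
  match k with RealScalars => R | ComplexScalars => R[i] end.

Definition sconj (R : realType) (k : scalar_kind) :
    scalarField R k -> scalarField R k :=
  match k with
  | RealScalars => fun z : R => z
  | ComplexScalars => fun z : R[i] => conjc z
  end.
Arguments sconj : clear implicits.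

(* A Hilbert space is a complete normed space [H] with a positive definite
   hermitian form [ip] (linear in its first argument) inducing the norm. *)
Definition induces_norm (K : numFieldType) (H : normedModType K)
    (ip : H -> H -> K) : Prop :=
  forall x : H, `|x| ^+ 2 = ip x x.

(* The values of [op_fun] outside [dom] are irrelevant: operators are compared
   by [op_sub] and [op_eq], not by Leibniz equality. *)
Record operator (T : Type) := Operator { dom : set T; op_fun :> T -> T }.

Section Operators.
Variables (K : numFieldType) (H : normedModType K).
Implicit Types A B S : operator H.

Definition linear_operator A : Prop :=
  dom A 0 /\
  forall (a : K) (x y : H), dom A x -> dom A y ->
    dom A (a *: x + y) /\ A (a *: x + y) = a *: A x + A y.

Definition densely_defined A : Prop := dense (dom A).

Definition op_sub A B : Prop :=
  dom A `<=` dom B /\ forall x, dom A x -> A x = B x.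

Definition op_eq A B : Prop :=
  dom A = dom B /\ forall x, dom A x -> A x = B x.

Definition op_id : operator H := Operator setT id.

Definition op_add A B : operator H :=
  Operator (dom A `&` dom B) (fun x => A x + B x).

(* [op_mul B A] is BA, i.e. first [A], then [B]. *)
Definition op_mul B A : operator H :=
  Operator [set x | dom A x /\ dom B (A x)] (fun x => B (A x)).

Definition bounded_operator S : Prop :=
  [/\ linear_operator S, dom S = setT &
      exists M : K, forall x : H, `|S x| <= M * `|x|].

Definition is_inverse A S : Prop :=
  [/\ bounded_operator S,
      op_sub (op_mul S A) (op_mul A S) &
      op_eq (op_mul A S) op_id].

Definition invertible A : Prop := exists S, is_inverse A S.

(* The inverse is unique up to [op_eq]; [op_id] is a dummy value, used only if
   [A] is not invertible. *)
Definition op_inv A : operator H :=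
  if pselect (invertible A) is left invA then projT1 (cid invA) else op_id.

(* For densely defined [A], the [z] below is unique. *)
Definition adjoint (ip : H -> H -> K) A : operator H :=
  let rep y := [set z | forall x, dom A x -> ip (A x) y = ip x z] in
  Operator [set y | exists z, rep y z] (fun y => xget 0 (rep y)).

End Operators.

(* Main.v *)
(** Write A', B' for the adjoints.  If [y] lies in the domain of (A+B)', with
    value [z], then AB = BA gives A B^-1 x = B^-1 A x on D(A), and testing [z]
    against B^-1 x yields A' B'^-1 y = B'^-1 z - y.  So [y] is in the domain of
    A' B'^-1, hence in D(B'), and then A' B'^-1 y is in D(B') as well.
    Transposing AB = BA once more, now through A^-1, gives
    y = (A^-1)' (z - B' y), i.e. [y] is in D(A') with A' y = z - B' y.
    The invertibility of B' and the operator (A^-1)' both come from Riesz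
    representation. *)
Require Import Defs.
From mathcomp Require Import all_boot all_order all_algebra sesquilinear.
From mathcomp Require Import complex ring.
From mathcomp Require Import all_classical all_reals all_analysis.

Set Implicit Arguments.
Unset Strict Implicit.
Unset Printing Implicit Defensive.

Import Order.TTheory GRing.Theory Num.Theory.
Import numFieldNormedType.Exports.
Local Open Scope classical_set_scope.
Local Open Scope ring_scope.

(* Norms take values in the scalar field, which for complex spaces is only
   partially ordered; this is the order completeness that Riesz needs. *)
Definition has_nonneg_infima (K : numFieldType) : Prop :=
  forall E : set K, E !=set0 -> (forall x, E x -> 0 <= x) ->
  exists m : K, [/\ 0 <= m, forall x, E x -> m <= x &
    forall e, 0 < e -> exists2 x, E x & x < m + e].

Lemma realType_has_nonneg_infima (R : realType) : has_nonneg_infima R.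
Proof.
move=> E E0 Ege0; exists (inf E).
have lbE : has_lbound E by exists 0 => x /Ege0.
split=> [|x Ex|e e0].
- exact: lb_le_inf.
- exact: ge_inf.
- exact: inf_adherent.
Qed.

(** Nonnegative complex numbers are real, so the infimum is found among the real parts and carried
    back. *)
Lemma complex_has_nonneg_infima (R : realType) : has_nonneg_infima R[i].
Proof.
move=> E [x0 Ex0] Ege0.
have Ereal x : E x -> real_complex R (complex.Re x) = x.
  by move=> /Ege0 x_ge0; rewrite RRe_real // ger0_real.
have [| |m [m_ge0 mlb mapprox]] :=
    @realType_has_nonneg_infima R ((@complex.Re R) @` E).
- by exists (complex.Re x0), x0.
- by move=> _ [x Ex <-]; rewrite -ler0c Ereal // Ege0.
exists (real_complex R m); split=> [|x Ex|e e_gt0].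
- by rewrite ler0c.
- by rewrite -(Ereal x) // lecR; apply: mlb; exists x.
- have e_real : real_complex R (complex.Re e) = e.
    by rewrite RRe_real // ger0_real // ltW.
  have [|_ [x Ex <-] ltx] := mapprox (complex.Re e).
    by rewrite -ltcR e_real.
  by exists x => //; rewrite -(Ereal x) // -e_real -raddfD /= ltcR.
Qed.

Lemma scalarField_has_nonneg_infima (R : realType) (k : scalar_kind) :
  has_nonneg_infima (scalarField R k).
Proof.
case: k; [exact: realType_has_nonneg_infima|exact: complex_has_nonneg_infima].
Qed.

(** The one property of conjugation that the Hilbert space arguments assume, so that they cover both
    scalar fields. *)
Lemma mul_sconj (R : realType) (k : scalar_kind) (z : scalarField R k) :
  z * sconj R k z = `|z| ^+ 2.
Proof.
case: k z => z /=; last by rewrite sqr_normc.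
by rewrite real_normK ?num_real// expr2.
Qed.

Section Hilbert.
Variables (K : numFieldType) (c : K -> K).
Hypothesis mul_conj : forall z, z * c z = `|z| ^+ 2.
Variables (H : completeNormedModType K) (ip : {dot H for c}).
Hypothesis ip_norm : induces_norm ip.

(** * Inner product identities and Cauchy-Schwarz *)

Lemma ipC (x y : H) : ip x y = c (ip y x).
Proof. by rewrite [LHS](@hermitian_subproof K H false c ip) expr0 mul1r. Qed.

(** Since [c] is an arbitrary function, even its value at 0 has to come from the symmetry of the
    form. *)
Lemma conj0 : c 0 = 0.
Proof. by have := ipC 0 0; rewrite (linear0r ip). Qed.

Lemma ipDl (x y z : H) : ip (x + y) z = ip x z + ip y z.
Proof. exact: linearDl. Qed.

Lemma ipBl (x y z : H) : ip (x - y) z = ip x z - ip y z.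
Proof. exact: linearBl. Qed.

Lemma ipZl a (x z : H) : ip (a *: x) z = a * ip x z.
Proof. exact: linearZl_LR. Qed.

Lemma ipDr (x y z : H) : ip z (x + y) = ip z x + ip z y.
Proof. exact: linearDr. Qed.

Lemma ipBr (x y z : H) : ip z (x - y) = ip z x - ip z y.
Proof. exact: linearBr. Qed.

Lemma ipZr a (x z : H) : ip z (a *: x) = c a * ip z x.
Proof. exact: linearZr_LR. Qed.

Lemma ip_mulC (x y : H) : ip x y * ip y x = `|ip x y| ^+ 2.
Proof. by rewrite (ipC y x) mul_conj. Qed.

Lemma ip_ext (u v : H) : (forall x, ip x u = ip x v) -> u = v.
Proof.
move=> uv; apply/eqP; rewrite -subr_eq0 -normr_eq0 -sqrf_eq0 ip_norm.
by rewrite ipBr uv subrr.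
Qed.

(** The vector is [|w| ^+ 2] times the component of [u] orthogonal to [w]; clearing the denominator
    keeps the identity valid for [w = 0]. *)
Lemma norm_proj (u w : H) :
  `| `|w| ^+ 2 *: u - ip u w *: w| ^+ 2 =
  `|w| ^+ 2 * (`|w| ^+ 2 * `|u| ^+ 2 - `|ip u w| ^+ 2).
Proof.
rewrite -[`|ip u w| ^+ 2]ip_mulC !ip_norm !ipBl !ipBr !ipZl !ipZr -!ipC.
ring.
Qed.

Lemma ip_CauchySchwarz (x y : H) : `|ip x y| <= `|x| * `|y|.
Proof.
rewrite -(@ler_pXn2r _ 2) ?nnegrE ?mulr_ge0 // exprMn.
have [->|y0] := eqVneq y 0.
  by rewrite (linear0r ip) !normr0 expr0n mulr0.
have: 0 <= `| `|y| ^+ 2 *: x - ip x y *: y| ^+ 2 by rewrite exprn_ge0.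
rewrite norm_proj pmulr_rge0 ?exprn_gt0 ?normr_gt0 // subr_ge0.
by rewrite [X in _ <= X]mulrC.
Qed.

(** If [w = u - v] were nonzero, some [x] in [D] would lie closer to [w] than [|w|]; being
    orthogonal to [w], it would contradict Cauchy-Schwarz for [w - x] and [w]. *)
Lemma dense_ip_ext (D : set H) (u v : H) : dense D ->
  (forall x, D x -> ip x u = ip x v) -> u = v.
Proof.
move=> denseD uv; apply/eqP; rewrite -subr_eq0; apply/negPn/negP => w0.
set w := u - v in w0; have wgt0 : 0 < `|w| by rewrite normr_gt0.
have [||x [xw Dx]] := denseD (ball w `|w|).
- by exists w; exact: ballxx.
- exact: ball_open.
have xw0 : ip x w = 0 by rewrite ipBr uv // subrr.
move: xw; rewrite -ball_normE /= => lt_wx.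
have := ip_CauchySchwarz (w - x) w; rewrite ipBl xw0 subr0 -ip_norm.
by rewrite normrX normr_id expr2 ler_pM2r // (lt_geF lt_wx).
Qed.

Hypothesis infK : has_nonneg_infima K.

(** * Riesz representation *)

Section Riesz.
Variables (f : H -> K) (M : K).
Hypothesis linf : forall a x y, f (a *: x + y) = a * f x + f y.
Hypothesis bndf : forall x, `|f x| <= M * `|x|.

Let fD x y : f (x + y) = f x + f y.
Proof. by rewrite -{1}[x]scale1r linf mul1r. Qed.

Let f0 : f 0 = 0.
Proof. by apply: (addIr (f 0)); rewrite -fD !add0r. Qed.

Let fZ a x : f (a *: x) = a * f x.
Proof. by rewrite -[a *: x]addr0 linf f0 addr0. Qed.

Let fB x y : f (x - y) = f x - f y.
Proof. by rewrite fD -scaleN1r fZ mulN1r. Qed.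

(* The Riesz vector is a multiple of the point of least norm on the affine
   hyperplane [f = 1]. *)
Lemma Riesz_representation : exists z, forall x, f x = ip x z.
Proof.
have [[x0 fx0]|f_eq0] := pselect (exists x, f x != 0); last first.
  exists 0 => x; rewrite (linear0r ip); apply: contrapT => fx.
  by apply: f_eq0; exists x; apply/eqP.
have [||m [m_ge0 mlb mapprox]] := infK (E := [set `|x| | x in f @^-1` [set 1]]).
- by exists `|(f x0)^-1 *: x0|, ((f x0)^-1 *: x0) => //=; rewrite fZ mulVf.
- by move=> _ [x _ <-].
(* Homogeneous form of the lower bound, applied below to vectors off the hyperplane. *)
have mle u : m * `|f u| <= `|u|.
  have [->|fu] := eqVneq (f u) 0; first by rewrite normr0 mulr0.
  rewrite -ler_pdivlMr ?normr_gt0 // mulrC -normfV -normrZ.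
  by apply: mlb; exists ((f u)^-1 *: u) => //=; rewrite fZ mulVf.
pose S e := [set x | f x = 1 /\ `|x| < m + e].
(* The filter of near-minimizers plays the role of a minimizing sequence. *)
pose F := filter_from [set e : K | 0 < e] S.
have FF : ProperFilter F.
  apply: filter_from_proper; last first.
    by move=> e /mapprox[_ [x fx <-] xlt]; exists x.
  apply: filter_from_filter; first by exists 1 => /=.
  move=> i j /= i0 j0.
  have [ij|ji] := real_leP (ger0_real (ltW i0)) (ger0_real (ltW j0)).
    exists i => // x [fx xi]; split; split=> //.
    by rewrite (lt_le_trans xi)// lerD2l.
  exists j => // x [fx xj]; split; split=> //.
  by rewrite (lt_le_trans xj)// lerD2l ltW.
have parallelogram (u v : H) :
    `|u - v : H| ^+ 2 = 2 * (`|u| ^+ 2 + `|v| ^+ 2) - `|u + v| ^+ 2.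
  rewrite !ip_norm !ipBl !ipDl !ipBr !ipDr; ring.
have cF : cauchy F.
  apply: cauchy_exP => d d0.
  (* The parallelogram law bounds [|u - v| ^+ 2] by [4 * e * (2 * m + e)]. The summand [d ^+ 2] in
     the denominator forces [e < 1], and then [8 * m + 4] brings the bound below [d ^+ 2]. *)
  pose e := d ^+ 2 / (8 * m + 4 + d ^+ 2).
  have den0 : 0 < 8 * m + 4 + d ^+ 2.
    by rewrite addr_gt0 ?exprn_gt0// ltr_wpDl// mulr_ge0.
  have e0 : 0 < e by rewrite divr_gt0 ?exprn_gt0.
  have e1 : e < 1.
    by rewrite ltr_pdivrMr// mul1r ltrDr ltr_wpDl// mulr_ge0.
  have ed : 4 * e * (2 * m + e) < d ^+ 2.
    have : e * (8 * m + 4 + d ^+ 2) = d ^+ 2 by rewrite mulfVK// gt_eqF.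
    move=> <-; rewrite -subr_gt0.
    have -> : e * (8 * m + 4 + d ^+ 2) - 4 * e * (2 * m + e) =
              e * (4 * (1 - e) + d ^+ 2) by ring.
    by rewrite mulr_gt0// addr_gt0 ?exprn_gt0// mulr_gt0// subr_gt0.
  have [_ [u fu <-] ult] := mapprox e e0.
  exists u, e => // v [fv vlt].
  rewrite -ball_normE /= -(@ltr_pXn2r _ 2) ?nnegrE// ?(ltW d0)//.
  apply: le_lt_trans ed; rewrite parallelogram.
  have sq_lt w : `|w| < m + e -> `|w| ^+ 2 <= (m + e) ^+ 2.
    by move=> /ltW wlt; rewrite lerXn2r ?nnegrE// (le_trans _ wlt)//.
  have : (2 * m) ^+ 2 <= `|u + v| ^+ 2.
    rewrite lerXn2r ?nnegrE ?mulr_ge0//.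
    have := mle (u + v); rewrite fD fu fv -mulr2n normr_nat.
    by rewrite mulrC.
  have -> : 4 * e * (2 * m + e) =
      2 * ((m + e) ^+ 2 + (m + e) ^+ 2) - (2 * m) ^+ 2 by ring.
  move=> uv; apply: lerB => //.
  by rewrite ler_wpM2l// lerD// sq_lt.
have /cauchy_cvg/cvg_ex[z Fz] := cF.
have near_z e : 0 < e -> exists u, [/\ f u = 1, `|u| < m + e & `|z - u| < e].
  move=> e0; have zF : F (ball z e) by apply: Fz; exact: nbhsx_ballx.
  have SF : F (S e) by exists e.
  have [u [[fu ult] zu]] := filter_ex (filterI SF zF).
  by exists u; split=> //; move: zu; rewrite -ball_normE.
have fz : f z = 1.
  apply/eqP; rewrite -subr_eq0 -normr_eq0; apply/negPn/negP => fz.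
  have d0 : 0 < `|f z - 1| by rewrite lt_def fz /=.
  have M0 : 0 < `|M| + 1 by rewrite ltr_wpDl.
  (* Nothing is known about the sign of [M], so [|M| + 1] serves as a positive bound. *)
  have [|u [fu _ zu]] := near_z (`|f z - 1| / (`|M| + 1)); first exact: divr_gt0.
  suff : `|f z - 1| < `|f z - 1| by rewrite ltxx.
  rewrite -{1}fu -fB; apply: le_lt_trans (bndf _) _.
  move: zu; rewrite ltr_pdivlMr// => /le_lt_trans; apply.
  have := normr_ge0 (f (z - u)) => /le_trans/(_ (bndf _))/ger0_norm <-.
  by rewrite normrM normr_id mulrC ler_wpM2l// lerDl.
have zm : `|z| <= m.
  have [//|mz] := real_leP (normr_real z) (ger0_real m_ge0).
  have [|u [_ um zu]] := near_z ((`|z| - m) / 2).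
    by rewrite divr_gt0// subr_gt0.
  suff : `|z| < `|z| by rewrite ltxx.
  rewrite -{1}[z](subrK u); apply: le_lt_trans (ler_normD _ _) _.
  have -> : `|z| = (`|z| - m) / 2 + (m + (`|z| - m) / 2) by field.
  exact: ltrD.
have ker w : f w = 0 -> ip z w = 0.
  move=> fw; have [->|w0] := eqVneq w 0; first exact: (linear0r ip).
  have w2 : 0 < `|w| ^+ 2 by rewrite exprn_gt0 ?normr_gt0.
  (* On this multiple of the component of [z] orthogonal to [w], [f] equals [|w| ^+ 2]; minimality
     of [z] then leaves no room for a nonzero [ip z w]. *)
  have := mle (`|w| ^+ 2 *: z - ip z w *: w).
  rewrite fB !fZ fz fw mulr0 subr0 mulr1 -(@ler_pXn2r _ 2) ?nnegrE ?mulr_ge0//.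
  rewrite norm_proj (ger0_norm (ltW w2)) exprMn [leLHS]mulrC.
  rewrite [X in X * _ <= _]expr2 -mulrA ler_pM2l//.
  rewrite lerBrDl -lerBrDr -mulrBr => lew; apply/eqP.
  rewrite -normr_eq0 -sqrf_eq0 eq_le exprn_ge0// andbT (le_trans lew)//.
  by rewrite pmulr_rle0// subr_le0 lerXn2r ?nnegrE.
have z0 : z != 0.
  by apply/eqP => z0; move: fz; rewrite z0 f0 => /esym/eqP; rewrite oner_eq0.
have z2 : 0 < `|z| ^+ 2 by rewrite exprn_gt0 ?normr_gt0.
exists ((`|z| ^+ 2)^-1 *: z) => x.
(* The vector [x - f x *: z] lies in the kernel of [f], hence is orthogonal to [z]. *)
have ipxz : ip x z = f x * `|z| ^+ 2.
  apply/eqP; rewrite ip_norm -ipZl -subr_eq0 -ipBl ipC ker ?conj0 //.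
  by rewrite fB fZ fz mulr1 subrr.
have cz : c (`|z| ^+ 2)^-1 = (`|z| ^+ 2)^-1.
  have a0 : (`|z| ^+ 2)^-1 != 0 by rewrite invr_eq0 gt_eqF.
  apply: (mulfI a0); rewrite mul_conj ger0_norm ?invr_ge0 ?(ltW z2) //.
by rewrite ipZr cz ipxz mulrC mulfK ?gt_eqF.
Qed.

End Riesz.

(** * Adjoints and inverses of operators *)

Lemma bounded_has_adjoint (S : operator H) : bounded_operator S ->
  exists2 T : H -> H, bounded_operator (Operator setT T) &
    forall x y, ip (S x) y = ip x (T y).
Proof.
move=> [[_ linS] domS [M bndS]].
have inS x : dom S x by rewrite domS.
have [y|T ST] := @choice _ _ (fun y z => forall x, ip (S x) y = ip x z).
  apply: (@Riesz_representation (fun x => ip (S x) y) (M * `|y|)).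
  - by move=> a u v; rewrite (linS a u v (inS u) (inS v)).2 ipDl ipZl.
  - move=> x; rewrite (le_trans (ip_CauchySchwarz _ _))// mulrAC.
    by rewrite ler_wpM2r.
exists T => [|//]; split=> //.
- split=> // a x y _ _; split=> //; apply: ip_ext => u /=.
  by rewrite ipDr ipZr -!ST ipDr ipZr.
(* The bound of [S] is inherited by cancelling [|T y|] in [|T y| ^+ 2 = ip (S (T y)) y]. For
   [T y = 0], nonnegativity of [M * |y|] comes from the bound on [S y]. *)
- exists M => y /=; have [->|Ty0] := eqVneq (T y) 0.
    rewrite normr0; have := bndS y.
    have [->|y0] := eqVneq y 0; first by rewrite normr0 mulr0.
    exact: le_trans.
  rewrite -(@ler_pM2l _ `|T y|) ?normr_gt0// -expr2 ip_norm -ST.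
  have := ip_CauchySchwarz (S (T y)) y.
  have : 0 <= ip (S (T y)) y by rewrite ST -ip_norm exprn_ge0.
  move=> /ger0_norm -> /le_trans; apply.
  by rewrite mulrA [`|T y| * M]mulrC ler_wpM2r.
Qed.

Lemma inverse_l (A S : operator H) x : is_inverse A S -> dom A x -> S (A x) = x.
Proof.
move=> [[_ domS _] [subA eqA] [_ eqAS]] Ax.
have SAx : dom (op_mul S A) x by split=> //; rewrite domS.
by rewrite [LHS](eqA x SAx) (eqAS x (subA x SAx)).
Qed.

Lemma inverse_r (A S : operator H) x : is_inverse A S ->
  dom A (S x) /\ A (S x) = x.
Proof.
move=> [_ _ [domAS eqAS]].
have ASx : dom (op_mul A S) x by rewrite domAS.
by split; [case: ASx|exact: eqAS].
Qed.

Lemma adjointP (A : operator H) x y : dom (adjoint ip A) y -> dom A x ->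
  ip (A x) y = ip x (adjoint ip A y).
Proof. by move=> /(xgetPex 0) /[apply]. Qed.

(** Density makes the representing vector unique, which determines the value picked by [xget]. *)
Lemma adjointE (A : operator H) y z : densely_defined A ->
  (forall x, dom A x -> ip (A x) y = ip x z) -> adjoint ip A y = z.
Proof.
move=> denseA Az; apply: (dense_ip_ext denseA) => x Ax.
by rewrite -adjointP ?Az//; exists z.
Qed.

(** The inverse of the adjoint is [T], the adjoint of the bounded inverse of [B]. *)
Lemma adjoint_invertible (B : operator H) : densely_defined B ->
  invertible B -> invertible (adjoint ip B).
Proof.
move=> denseB [S invS]; have [bndS _ _] := invS.
have [T bndT ST] := bounded_has_adjoint bndS.
have TB y x : dom B x -> ip (B x) (T y) = ip x y.
  by move=> Bx; rewrite -ST (inverse_l invS).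
have domT y : dom (adjoint ip B) (T y) by exists y => x; exact: TB.
have BT y : adjoint ip B (T y) = y by apply: adjointE => // x; exact: TB.
exists (Operator setT T); split=> //.
- split=> [y [By _]|y [By _]]; first by split=> //; exact: domT.
  rewrite [RHS]BT; apply: ip_ext => x /=.
  by have [BSx BSxE] := inverse_r x invS; rewrite -ST -adjointP// BSxE.
- by split=> [|y _ /=]; [apply/seteqP; split|exact: BT].
Qed.

Lemma op_invP (B : operator H) : invertible B -> is_inverse B (op_inv B).
Proof. by rewrite /op_inv; case: pselect => // invB _; case: cid. Qed.

Lemma inverse_commute (A B SA SB : operator H) x :
  is_inverse A SA -> is_inverse B SB -> op_eq (op_mul A B) (op_mul B A) ->
  dom A x -> dom A (SB x) /\ A (SB x) = SB (A x).
Proof.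
move=> invA invB [domAB eqAB] Ax.
have [BSB BSBE] := inverse_r (A x) invB.
have [ASA ASAE] := inverse_r (SB (A x)) invA.
(* The point [u = SA (SB (A x))] turns out to be [SB x]: commutation gives
   [A (B u) = B (A u) = A x], and [A] is injective. *)
have BAu : dom (op_mul B A) (SA (SB (A x))) by split=> //; rewrite ASAE.
have ABu := BAu; rewrite -domAB in ABu; have [Bu ABu'] := ABu.
have Bux : B (SA (SB (A x))) = x.
  rewrite -[LHS](inverse_l invA ABu') -[RHS](inverse_l invA Ax).
  by congr (SA _); rewrite [LHS](eqAB _ ABu) /= ASAE.
by rewrite -{1 2}Bux (inverse_l invB Bu).
Qed.

(** * The adjoint of the sum *)

(** The easy inclusion, of A' + B' in (A+B)'. *)
Lemma adjoint_addP (A B : operator H) y x :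
  dom (op_add (adjoint ip A) (adjoint ip B)) y -> dom (op_add A B) x ->
  ip (op_add A B x) y = ip x (op_add (adjoint ip A) (adjoint ip B) y).
Proof. by move=> [Ay By] [Ax Bx]; rewrite ipDl ipDr -!adjointP. Qed.

Lemma adjoint_add_dom (A B : operator H) :
  densely_defined B -> invertible A -> invertible B ->
  op_eq (op_mul A B) (op_mul B A) ->
  dom (op_mul (adjoint ip A) (op_inv (adjoint ip B))) `<=` dom (adjoint ip B) ->
  dom (adjoint ip (op_add A B)) `<=` dom (op_add (adjoint ip A) (adjoint ip B)).
Proof.
move=> denseB [SA invSA] [SB invSB] commAB domAB.
have invV := op_invP (adjoint_invertible denseB (ex_intro _ SB invSB)).
(* Only the inverse property of [V] is kept; the choice inside [op_inv] is forgotten. *)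
move: (op_inv _) domAB invV => V domAB invV.
have [bndSA _ _] := invSA; have [TA _ STA] := bounded_has_adjoint bndSA.
have [[_ domV _] _ _] := invV.
move=> y [z yz].
have [BVy BVyE] := inverse_r y invV; have [BVz BVzE] := inverse_r z invV.
(* This says that [V y] lies in the domain of A' with value [V z - y]; the defining relation of [z]
   is tested at [SB x]. *)
have AVy x : dom A x -> ip (A x) (V y) = ip x (V z - y).
  move=> Ax; have [ASBx ASBxE] := inverse_commute invSA invSB commAB Ax.
  have [BSBx BSBxE] := inverse_r x invSB.
  have [BSBAx BSBAxE] := inverse_r (A x) invSB.
  have := yz (SB x) (conj ASBx BSBx); rewrite /= ASBxE BSBxE ipDl -{1}BVzE.
  rewrite -adjointP// BSBxE ipBr => <-; rewrite addrK.
  by rewrite -{1}BSBAxE adjointP // BVyE.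
have By : dom (adjoint ip B) y.
  by apply: domAB; split; [rewrite domV|exists (V z - y)].
(* Testing on D(B) puts [SA u] in D(BA) = D(AB), so [B u] becomes [A (B (SA u))] and [AVy] applies
   at [B (SA u)]. *)
have yE : y = TA (z - adjoint ip B y).
  apply: (dense_ip_ext denseB) => u Bu.
  rewrite -STA -{1}BVyE -adjointP//.
  have [ASAu ASAuE] := inverse_r u invSA.
  have BAu : dom (op_mul B A) (SA u) by split=> //; rewrite ASAuE.
  have ABu := BAu; rewrite -(proj1 commAB) in ABu.
  have := proj2 commAB _ ABu; rewrite /= ASAuE => <-.
  case: ABu => BSAu ABSAu; rewrite AVy// ipBr -BVzE -?adjointP//.
  by rewrite BVzE ipBr -(adjointP By)// -[in RHS]BVzE -adjointP.
(* Since [y] is in the range of [TA], pairing it with [A x] cancels [SA] against [A]. *)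
split=> //; exists (z - adjoint ip B y) => x Ax.
by rewrite {1}yE -STA (inverse_l invSA).
Qed.

End Hilbert.

Theorem theorem4 (R : realType) (k : scalar_kind)
    (H : completeNormedModType (scalarField R k))
    (ip : {dot H for sconj R k}) (ip_norm : induces_norm ip)
    (A B : operator H)
    (linA : linear_operator A) (linB : linear_operator B)
    (invA : invertible A) (invB : invertible B)
    (denseA : densely_defined A) (denseB : densely_defined B)
    (denseAB : densely_defined (op_mul A B))
    (denseBA : densely_defined (op_mul B A))
    (dense_add : densely_defined (op_add A B))
    (dense_add_adj :
      densely_defined (op_add (adjoint ip A) (adjoint ip B)))
    (dense_mul_adj :
      densely_defined (op_mul (adjoint ip A) (op_inv (adjoint ip B))))
    (commAB : op_eq (op_mul A B) (op_mul B A))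
    (domAB : dom (op_mul (adjoint ip A) (op_inv (adjoint ip B)))
               `<=` dom (adjoint ip B)) :
  op_eq (adjoint ip (op_add A B)) (op_add (adjoint ip A) (adjoint ip B)).
Proof.
have ipK := @mul_sconj R k.
have infK := @scalarField_has_nonneg_infima R k.
have domE : dom (adjoint ip (op_add A B)) =
            dom (op_add (adjoint ip A) (adjoint ip B)).
  apply/seteqP; split=> y Dy.
    exact: (adjoint_add_dom ipK ip_norm infK denseB invA invB commAB domAB).
  exists (op_add (adjoint ip A) (adjoint ip B) y) => x; exact: adjoint_addP.
(* The values agree because D(A+B) is dense. *)
split=> // y; rewrite domE => Dy.
by apply: (adjointE ipK ip_norm dense_add) => x; exact: adjoint_addP.
Qed.
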